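(* Let $f$ and $g$ be continuous real-valued functions on $\mathbb{R}^2$, each supported in a compact set contained in the open half-plane $\{(x,y): y>0\}$. Let $(x,y)\in\mathbb{R}^2$ with $y>0$. Suppose there is an open neighborhood $U\subset\mathbb{R}$ of $x$ such that $Mf(p,r)=Mg(p,r)$ for all $p\in U$ and all $0\le r\le y$. Then $f(x,y)=g(x,y)$. (That is, the value $f(x,y)$ depends only on the values of $Mf$ on a neighborhood of the point $(x,0)$ of $L$ and radii $0\le r\le y$.)
   Context: Use Cartesian coordinates on $\mathbb{R}^2$ in which the line $L$ is the $x$-axis. For a continuous function $h$ on $\mathbb{R}^2$, the circular mean Radon transform with centers on $L$ is $Mh(p,r)=\frac{1}{2\pi}\int_{-\pi}^{\pi} h(p+r\sin\varphi,\, r\cos\varphi)\,d\varphi$ for $p\in\mathbb{R}$ (identified with the point $(p,0)\in L$) and $r\ge 0$; it is the average of $h$ over the circle of radius $r$ centered at $(p,0)$. *)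

(* Defs.v *)
From HB Require Import structures.
From mathcomp Require Import all_boot all_order all_algebra.
From mathcomp Require Import all_classical all_reals all_analysis.
Set Implicit Arguments. Unset Strict Implicit. Unset Printing Implicit Defensive.
Import Order.TTheory GRing.Theory Num.Theory.
Import numFieldTopology.Exports numFieldNormedType.Exports.
Local Open Scope classical_set_scope.
Local Open Scope ring_scope.

Definition circ_mean {R : realType} (h : R * R -> R) (p r : R) : R :=
  (2 * pi)^-1 * Rintegral (@lebesgue_measure R) `[- pi, pi]%classic
    (fun phi : R => h (p + r * sin phi, r * cos phi)).

Definition supp_compact_upper {R : realType} (h : R * R -> R) : Prop :=
  exists K : set (R * R), compact K /\ (forall z, K z -> 0 < z.2) /\
    (forall z, ~ K z -> h z = 0).

(* Main.v *)
Require Import Defs.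
From HB Require Import structures.
From mathcomp Require Import all_boot all_order all_algebra.
From mathcomp Require Import all_classical all_reals all_analysis.
From mathcomp Require Import ring lra.
Import Order.TTheory GRing.Theory Num.Theory.
Import numFieldTopology.Exports numFieldNormedType.Exports.
Local Open Scope classical_set_scope.
Local Open Scope ring_scope.

(** Only [h = f - g] matters. Since [h] vanishes near the axis, [h / v] is a
    continuous function [k] of [(u, w) = (u, u ^ 2 + v ^ 2)], and in these
    coordinates the circle of centre [p] and radius [r] is the line
    [w = c + 2 p u] with [c = r ^ 2 - p ^ 2]. The hypothesis becomes that the
    integrals of [k] in [u] along these lines vanish for [p] in [U] and
    [c < y ^ 2 - p ^ 2]. If they do, so do those of [u k]: the integrals of the
    [w]-primitive of [k] have zero [c]-derivative, hence vanish, and twice the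
    integral of [u k] is their [p]-derivative. So all moments of [k] along each
    line vanish, whence [k] vanishes on the line. *)

(** * Continuity and integrals depending on a parameter *)

Lemma integrable_continuous {R : realType} (f : R -> R) (a b : R) :
  continuous f -> (@lebesgue_measure R).-integrable `[a, b] (EFin \o f).
Proof.
move=> cf; apply: continuous_compact_integrable; first exact: segment_compact.
exact: continuous_subspaceT.
Qed.

Lemma continuous_curve {R : realType} (k : R -> R -> R) (a b : R -> R) :
  continuous (fun z : R * R => k z.1 z.2) -> continuous a -> continuous b ->
  continuous (fun t => k (a t) (b t)).
Proof.
move=> ck ca cb t.
apply: (@continuous_comp _ _ _ (fun t : R => (a t, b t)) (fun z : R * R => k z.1 z.2)); last exact: ck.
exact: (@cvg_pair _ _ _ (nbhs t) (nbhs (a t)) (nbhs (b t)) _ _ _ _ _ (ca t) (cb t)).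
Qed.

Lemma continuous_uncurry_l {R : realType} (k : R -> R -> R) (u : R) :
  continuous (fun z : R * R => k z.1 z.2) -> continuous (k u).
Proof.
by move=> ck; apply: (continuous_curve k (fun=> u) id) => // w; [exact: cst_continuous|exact: cvg_id].
Qed.

(** Dominated convergence: the constant [M] is integrable on the bounded interval. Continuity is
    local, so a window of radius 1 around [u] is enough. *)
Lemma continuous_Rintegral_param {R : realType} (k : R -> R -> R) (a b M : R) :
  continuous (fun z : R * R => k z.1 z.2) ->
  (forall u t, `|k u t| <= M) ->
  continuous (fun u => \int[lebesgue_measure]_(t in `[a, b]) k u t).
Proof.
move=> ck kM u.
have := @continuity_under_integral R _ _ lebesgue_measure k `[a, b]
  (measurable_itv _) (u - 1) (u + 1) _ _ (fun=> M).
move=> H.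
have Iu : u \in (`](u - 1), (u + 1)[%classic : set R).
  by rewrite inE /= in_itv /= ltrBlDr !ltrDl ltr01.
apply: (H _ _ _ _ u Iu).
- by move=> x _; apply: integrable_continuous; exact: continuous_uncurry_l.
- apply: aeW => t _ x _.
  apply: (continuous_curve k id (fun=> t)).
  + exact: ck.
  + by move=> z; exact: cvg_id.
  + exact: cst_continuous.
- apply: (integrable_continuous (fun=> M)); exact: cst_continuous.
- by move=> x _; apply: aeW => t _; exact: kM.
Qed.

(** * Constant integrands and the primitive in the second variable *)

Lemma integrable_cst_itv {R : realType} (a b c : R) :
  (@lebesgue_measure R).-integrable `[a, b] (EFin \o (fun=> c)).
Proof.
by apply: (integrable_continuous (fun=> c)); exact: cst_continuous.
Qed.

Lemma Rintegral_cst_itv {R : realType} (a b c : R) : a <= b ->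
  \int[lebesgue_measure]_(u in `[a, b]) (fun=> c) u = c * (b - a).
Proof.
move=> ab; rewrite Rintegral_cst; last exact: measurable_itv.
have -> : fine (@lebesgue_measure R `[a, b]%classic) = b - a; last by [].
rewrite lebesgue_measure_itv /= lte_fin.
rewrite -EFinD; case: ltP => // ba; apply/eqP; rewrite eq_sym subr_eq0 eq_le ba; exact: ab.
Qed.

(** The lower bound [-1] is any negative number: [k u] will vanish on [w <= 0],
    and the primitive must be differentiable at [0]. *)
Definition prim {R : realType} (k : R -> R -> R) (u w : R) : R :=
  \int[lebesgue_measure]_(t in `[(-1), w]) k u t.

Lemma prim_eq0 {R : realType} (k : R -> R -> R) (u w : R) :
  (forall u w : R, w <= 0 -> k u w = 0) -> w <= 0 -> prim k u w = 0.
Proof.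
move=> k0 w0; rewrite /prim (@eq_Rintegral _ _ _ _ _ (fun=> 0)).
  by rewrite Rintegral_cst ?mul0r//; exact: measurable_itv.
by move=> t; rewrite inE /= in_itv /= => /andP[_ tw]; rewrite k0// (le_trans tw).
Qed.

(** For [w < 0] the primitive is locally zero, as is [k]; for [0 <= w] the point lies strictly to
    the right of [-1] and the fundamental theorem of calculus applies. *)
Lemma is_derive_prim {R : realType} (k : R -> R -> R) (u w : R) :
  continuous (fun z : R * R => k z.1 z.2) ->
  (forall u w : R, w <= 0 -> k u w = 0) ->
  is_derive w 1 (prim k u) (k u w).
Proof.
move=> ck k0.
have cku : continuous (k u) by exact: continuous_uncurry_l.
have [w0|w0] := ltP w 0.
  have H : \forall w \near w, 0 = prim k u w.
    near=> w'; rewrite prim_eq0//; apply: ltW; near: w'.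
    exact: lt_nbhsl.
  rewrite k0 ?ltW//.
  exact: (@near_eq_is_derive _ _ _ (fun=> 0) _ _ _ _ H (is_derive_cst _ _ _)).
have [] := @continuous_FTC1 R (k u) (BLeft (-1)) w (w + 1).
- by rewrite ltrDl.
- exact: integrable_continuous.
- by rewrite /= lte_fin (lt_le_trans _ w0)// ltrN10.
- exact: cku.
by move=> dK vK; apply: DeriveDef => //; rewrite -derive1E.
Unshelve. all: by end_near. Qed.

Lemma prim_lipschitz {R : realType} (k : R -> R -> R) (M u w w' : R) :
  continuous (fun z : R * R => k z.1 z.2) ->
  (forall u t, `|k u t| <= M) ->
  (forall u w : R, w <= 0 -> k u w = 0) ->
  `|prim k u w' - prim k u w| <= M * `|w' - w|.
Proof.
move=> ck kM k0.
wlog ww : w w' / w < w'.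
  move=> H; have [|w'w|<-] := ltgtP w w'; first exact: H.
    by rewrite distrC (distrC w'); exact: H.
  by rewrite !subrr normr0 mulr0.
have dK (x : R) : x \in `]w, w'[ -> is_derive x 1 (prim k u) (k u x).
  by move=> _; exact: is_derive_prim.
have [|c _ ->] := MVT ww dK.
  by apply: derivable_within_continuous => x _; case: (is_derive_prim k u x ck k0).
by rewrite normrM ler_wpM2r.
Qed.

(** Continuity in [u] at fixed [w], combined with a Lipschitz bound in [w] that is uniform in [u],
    gives joint continuity. *)
Lemma continuous_prim {R : realType} (k : R -> R -> R) (M : R) :
  continuous (fun z : R * R => k z.1 z.2) ->
  (forall u t, `|k u t| <= M) ->
  (forall u w : R, w <= 0 -> k u w = 0) ->
  continuous (fun z : R * R => prim k z.1 z.2).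
Proof.
move=> ck kM k0 [u w].
have M0 : 0 <= M by rewrite (le_trans _ (kM 0 0)).
apply/cvgrPdist_lt => /= e e0.
have cK : continuous (prim k ^~ w) by exact: (continuous_Rintegral_param k (-1) w M ck kM).
have e20 : 0 < e / 2 by rewrite divr_gt0.
(* Dividing by [M + 1] rather than [M] covers the case [M = 0]. *)
have d0 : 0 < e / 2 / (M + 1) by rewrite divr_gt0// ltr_wpDl.
have N1 : \forall z \near (u, w), `|prim k u w - prim k z.1 w| < e / 2.
  have /cvgrPdist_lt /(_ _ e20) H := cK u.
  exact: (cvg_fst (F := nbhs u) (G := nbhs w) H).
have N2 : \forall z \near (u, w), `|w - z.2| < e / 2 / (M + 1).
  have H : \forall v \near w, `|w - v| < e / 2 / (M + 1) by apply: nbhsx_ballx.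
  exact: (cvg_snd (F := nbhs u) (G := nbhs w) H).
near=> z.
have H1 : `|prim k u w - prim k z.1 w| < e / 2 by near: z.
have H2 : `|w - z.2| < e / 2 / (M + 1) by near: z.
have H3 := prim_lipschitz k M z.1 z.2 w ck kM k0.
have -> : prim k u w - prim k z.1 z.2 =
  (prim k u w - prim k z.1 w) + (prim k z.1 w - prim k z.1 z.2) by ring.
rewrite (le_lt_trans (ler_normD _ _))// [ltRHS](splitr e) ltr_leD//.
rewrite (le_trans H3)//.
rewrite (@le_trans _ _ ((M + 1) * (e / 2 / (M + 1))))//.
  by apply: ler_pM => //; [rewrite lerDl|exact: ltW].
by rewrite mulrC divfK// gt_eqF// ltr_wpDl.
Unshelve. all: by end_near. Qed.

(** * Differentiation under the integral and the passage to the next moment *)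

(** The affine form [c u + s * e u] serves two derivatives at once: [e = 1] differentiates in the
    offset of the line, [e u = 2 * u] in the centre. The integrand derivatives are dominated by
    [|e u| * M]. *)
Lemma is_derive_Rintegral_prim {R : realType} (k : R -> R -> R) (M a b : R)
    (c e : R -> R) (s : R) :
  continuous (fun z : R * R => k z.1 z.2) ->
  (forall u t, `|k u t| <= M) ->
  (forall u w : R, w <= 0 -> k u w = 0) ->
  continuous c -> continuous e ->
  is_derive s 1
    (fun s => \int[lebesgue_measure]_(u in `[a, b]) prim k u (c u + s * e u))
    (\int[lebesgue_measure]_(u in `[a, b]) (e u * k u (c u + s * e u))).
Proof.
move=> ck kM k0 cc ce.
have M0 : 0 <= M by rewrite (le_trans _ (kM 0 0)).
pose f (s u : R) := prim k u (c u + s * e u).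
have df (x u : R) : is_derive x 1 (f ^~ u) (k u (c u + x * e u) * e u).
  apply: (@is_derive1_comp _ (prim k u) (fun x => c u + x * e u)).
    exact: is_derive_prim.
  have d : is_derive x 1 ((fun=> c u) + (e u \*: id)) (0 + e u *: 1).
    by apply: is_deriveD.
  rewrite add0r /GRing.scale /= mulr1 in d.
  apply: (@near_eq_is_derive _ _ _ _ _ _ _ _ _ d).
  by near=> t; rewrite !fctE /GRing.scale /= mulrC.
have p1f (x u : R) : partial1of2 f x u = e u * k u (c u + x * e u).
  by rewrite partial1of2E (@derive_val _ _ _ _ _ _ _ (df x u)) mulrC.
have Is : `](s - 1), (s + 1)[%classic s.
  by rewrite /= in_itv /= ltrBlDr !ltrDl ltr01.
have intf x : `](s - 1), (s + 1)[%classic x ->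
    (@lebesgue_measure R).-integrable `[a, b] (EFin \o f x).
  move=> _; apply: integrable_continuous.
  apply: (continuous_curve (prim k) id (fun u => c u + x * e u)).
  - exact: (continuous_prim k M ck kM k0).
  - by move=> z; exact: cvg_id.
  - by move=> z; apply: cvgD; [exact: cc|apply: cvgM; [exact: cvg_cst|exact: ce]].
have intG : (@lebesgue_measure R).-integrable `[a, b] (EFin \o (fun u => `|e u| * M)).
  apply: integrable_continuous => z; apply: cvgM; last exact: cvg_cst.
  by apply: cvg_norm; exact: ce.
have := @cvg_differentiation_under_integral R _ _ lebesgue_measure f `[a, b]
  (measurable_itv _) s (s - 1) (s + 1) Is intf
  (fun x u _ _ => @ex_derive _ _ _ _ _ _ _ (df x u)) (fun u => `|e u| * M)
  (fun u => mulr_ge0 (normr_ge0 _) M0) intG.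
have G_ub x u : `](s - 1), (s + 1)[%classic x -> `[a, b]%classic u ->
    `|partial1of2 f x u| <= `|e u| * M.
  by move=> _ _; rewrite p1f normrM ler_wpM2l.
move=> /(_ G_ub) H.
rewrite (@eq_Rintegral _ _ R (@lebesgue_measure R) _ (partial1of2 f s)); last by move=> u _; rewrite p1f.
have H' : (fun h => h^-1 *: ((fun s => \int[lebesgue_measure]_(u in `[a, b]) f s u) (h *: 1 + s) -
      \int[lebesgue_measure]_(u in `[a, b]) f s u)) @ 0^' -->
    \int[lebesgue_measure]_(u in `[a, b]) partial1of2 f s u.
  by under eq_fun do rewrite [_ *: 1]mulr1; exact: H.
apply: DeriveDef.
  by apply/cvg_ex; eexists; exact: H'.
exact/cvg_lim.
Unshelve. all: by end_near. Qed.

(** Differentiating in the centre [p] brings down the factor [u]; this needs vanishing for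
    neighbouring centres, hence an open [U]. The function [k] is kept general so that the step can
    be repeated with [u ^ n * k]. The number [y] will be the square of the largest radius. *)
Lemma line_integral_mul {R : realType} (k : R -> R -> R) (M B y : R)
    (U : set R) :
  0 <= B -> open U ->
  continuous (fun z : R * R => k z.1 z.2) ->
  (forall u t, `|k u t| <= M) ->
  (forall u w : R, w <= 0 -> k u w = 0) ->
  (forall p c : R, U p -> c < y - p ^+ 2 ->
    \int[lebesgue_measure]_(u in `[- B, B]) k u (c + 2 * p * u) = 0) ->
  forall p c : R, U p -> c < y - p ^+ 2 ->
    \int[lebesgue_measure]_(u in `[- B, B]) (u * k u (c + 2 * p * u)) = 0.
Proof.
move=> B0 oU ck kM k0 F0 p c Up cp.
pose G q c := \int[lebesgue_measure]_(u in `[- B, B]) prim k u (c + 2 * q * u).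
have G0 q : U q -> c < y - q ^+ 2 -> G q c = 0.
  move=> Uq cq.
  have dG (x : R) : is_derive x 1 (G q) (\int[lebesgue_measure]_(u in `[- B, B]) k u (x + 2 * q * u)).
    have cl : continuous (fun u : R => 2 * q * u).
      by move=> z; apply: cvgM; [exact: cvg_cst|exact: cvg_id].
    have c1 : continuous (fun u : R => 1 : R) by exact: cst_continuous.
    have := is_derive_Rintegral_prim k M (- B) B (fun u => 2 * q * u) (fun=> 1) x ck kM k0 cl c1.
    rewrite (_ : (fun s => _) = G q); last first.
      by apply/funext => s; apply: eq_Rintegral => u _; rewrite mulr1 addrC.
    rewrite (@eq_Rintegral _ _ R (@lebesgue_measure R) _ (fun u => k u (x + 2 * q * u)))//.
    by move=> u _; rewrite mul1r mulr1 addrC.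
  (* An offset so low that the line stays in [w <= 0] over [[- B, B]], so that [G q m = 0]. The mean
     value theorem carries this up to [c], since the derivative vanishes at every smaller offset. *)
  pose m := Num.min (c - 1) (- (2 * `|q| * B)).
  have mc : m < c by rewrite /m gt_min ltrBlDr ltrDl ltr01.
  have Gm : G q m = 0.
    rewrite /G (@eq_Rintegral _ _ R (@lebesgue_measure R) _ (fun=> 0)).
      by rewrite Rintegral_cst ?mul0r//; exact: measurable_itv.
    move=> u; rewrite inE /= in_itv /= => /andP[Bu uB].
    rewrite prim_eq0//.
    have : m <= - (2 * `|q| * B) by rewrite /m ge_min lexx orbT.
    have : q * u <= `|q| * B.
      rewrite (le_trans (ler_norm _))// normrM ler_wpM2l//.
      by rewrite ler_norml Bu uB.
    by lra.
  have [|x xmc] := MVT mc (fun x _ => dG x).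
    by apply: derivable_within_continuous => x _; case: (dG x).
  rewrite Gm subr0 => ->.
  move: xmc; rewrite in_itv /= => /andP[_ xc].
  by rewrite F0 ?mul0r// (lt_trans xc).
(* For fixed [c] both [U q] and [c < y - q ^+ 2] are open conditions on [q]. *)
have Gn : \forall q \near p, 0 = G q c.
  near=> q; rewrite G0//.
    by near: q; exact: open_nbhs_nbhs.
  have : q ^+ 2 < y - c; last by lra.
  near: q; apply: (cvgr_lt (p ^+ 2)); last by lra.
  exact: exprn_continuous.
have dG0 : is_derive p 1 (G ^~ c) 0.
  exact: (@near_eq_is_derive _ _ _ (fun=> 0) _ _ _ _ Gn (is_derive_cst _ _ _)).
have dG1 : is_derive p 1 (G ^~ c) (\int[lebesgue_measure]_(u in `[- B, B]) (2 * u * k u (c + 2 * p * u))).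
  have cl : continuous (fun u : R => 2 * u).
    by move=> z; apply: cvgM; [exact: cvg_cst|exact: cvg_id].
  have c1 : continuous (fun u : R => c) by exact: cst_continuous.
  have := is_derive_Rintegral_prim k M (- B) B (fun=> c) (fun u => 2 * u) p ck kM k0 c1 cl.
  rewrite (_ : (fun s => _) = G ^~ c); last first.
    by apply/funext => s; apply: eq_Rintegral => u _; rewrite mulrCA mulrA.
  rewrite (@eq_Rintegral _ _ R (@lebesgue_measure R) _ (fun u => 2 * u * k u (c + 2 * p * u)))//.
  by move=> u _; rewrite [p * _]mulrCA mulrA.
(* The two values found for the derivative of [G ^~ c] at [p] agree; it remains to cancel the factor
   2. *)
have := @derive_val _ _ _ _ _ _ _ dG0.
rewrite (@derive_val _ _ _ _ _ _ _ dG1).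
under eq_Rintegral do rewrite -mulrA.
rewrite RintegralZl; [|exact: measurable_itv|].
  by move/eqP; rewrite mulf_eq0 pnatr_eq0 /= => /eqP.
apply: integrable_continuous => z; apply: cvgM; first exact: cvg_id.
apply: (continuous_curve k id (fun u => c + 2 * p * u) ck).
  by move=> t; exact: cvg_id.
move=> t; apply: cvgD; first exact: cvg_cst.
by apply: cvgM; [exact: cvg_cst|exact: cvg_id].
Unshelve. all: by end_near. Qed.

(** * A continuous function on an interval is determined by its moments *)

Definition moments_vanish {R : realType} (B : R) (f : R -> R) : Prop :=
  forall n, \int[lebesgue_measure]_(u in `[- B, B]) (u ^+ n * f u) = 0.

Lemma continuous_moment {R : realType} (f : R -> R) (n : nat) :
  continuous f -> continuous (fun u : R => u ^+ n * f u).
Proof. by move=> cf z; apply: cvgM; [exact: exprn_continuous|exact: cf]. Qed.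

(** The new moment of order [n] combines the old ones of orders [n], [n + 1] and [n + 2]. Asking for
    all moments makes this iterable, so powers of a quadratic need no expansion. *)
Lemma moments_vanish_quadratic {R : realType} (B a b c : R) (f : R -> R) :
  continuous f -> moments_vanish B f ->
  moments_vanish B (fun u => (a + b * u + c * u ^+ 2) * f u).
Proof.
move=> cf f0 n.
have i m d : (@lebesgue_measure R).-integrable `[- B, B]
    (EFin \o (fun u => d * (u ^+ m * f u))).
  apply: integrable_continuous => z; apply: cvgM; first exact: cvg_cst.
  exact: continuous_moment.
have z m d : \int[lebesgue_measure]_(u in `[- B, B]) (d * (u ^+ m * f u)) = 0.
  rewrite RintegralZl ?f0 ?mulr0//; apply: integrable_continuous.
  exact: continuous_moment.
rewrite (@eq_Rintegral _ _ R (@lebesgue_measure R) _ (fun u =>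
  a * (u ^+ n * f u) + (b * (u ^+ n.+1 * f u) + c * (u ^+ n.+2 * f u)))).
  rewrite RintegralD//; last first.
    by apply: integrable_continuous => u; apply: cvgD; (apply: cvgM; [exact: cvg_cst|exact: continuous_moment]).
  by rewrite RintegralD// !z !addr0.
by move=> u _; rewrite !exprS; ring.
Qed.

(** Otherwise the powers of a quadratic polynomial exceeding [1] only near
    [u0] concentrate the integral around [u0]. *)
Lemma moments_vanish_le0 {R : realType} (B u0 : R) (f : R -> R) :
  continuous f -> moments_vanish B f -> `|u0| < B -> f u0 <= 0.
Proof.
move=> cf f0 u0B; rewrite leNgt; apply/negP => fu0.
have B0 : 0 < B by rewrite (le_lt_trans _ u0B).
pose e := f u0 / 2.
have e0 : 0 < e by rewrite divr_gt0.
have [d d0 [fd dB]] : exists2 d : R, 0 < d &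
    (forall u, `|u - u0| <= d -> e <= f u) /\ d + `|u0| <= B.
  have : \forall u \near u0, e < f u.
    by apply: (cvgr_gt (f u0) (cf u0)); rewrite /e; lra.
  move=> /nbhs_ballP [r /= r0 Hr].
  exists (Num.min (r / 2) (B - `|u0|)).
    by rewrite lt_min divr_gt0//= subr_gt0.
  split.
    move=> u; rewrite le_min => /andP[ur _]; apply/ltW/Hr.
    by rewrite /ball /= distrC (le_lt_trans ur)// ltr_pdivrMr// ltr_pMr// ltr1n.
  by rewrite -lerBrDr ge_min lexx orbT.
have [N0 /andP[N00 fN]] : exists N : R, (0 <= N) && `[< forall u, `|u| <= B -> `|f u| <= N >].
  have [||c _ cm] := @EVT_max _ (fun u => `|f u|) (- B) B.
  - by lra.
  - by apply: continuous_subspaceT => z; apply: cvg_norm; exact: cf.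
  exists `|f c|; rewrite normr_ge0 /=; apply/asboolP => u uB.
  by apply: cm; rewrite in_itv /= -ler_norml.
move/asboolP in fN.
(* On [[- B, B]] one has [(u - u0) ^+ 2 <= 4 * B ^+ 2 = 2 * D], so this scaling keeps [P] at least
   [-1]; beyond distance [d] from [u0] it is also at most 1. *)
pose D := 2 * B ^+ 2.
have D0 : 0 < D by rewrite mulr_gt0// exprn_gt0.
pose P u := 1 + (d ^+ 2 - (u - u0) ^+ 2) / D.
(* The excess of [P] over 1 at distance [d / 2] from [u0]. *)
pose q := 3 / 4 * d ^+ 2 / D.
have q0 : 0 < q by rewrite divr_gt0// mulr_gt0// ?exprn_gt0// divr_gt0.
have cP : continuous P.
  move=> z; apply: cvgD; first exact: cvg_cst.
  apply: cvgM; last exact: cvg_cst.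
  apply: cvgB; first exact: cvg_cst.
  apply: (@continuous_comp _ _ _ (fun z => z - u0) (fun z => z ^+ 2)).
    by apply: cvgB; [exact: cvg_id|exact: cvg_cst].
  exact: exprn_continuous.
have PE u : P u = (1 + (d ^+ 2 - u0 ^+ 2) / D) + (2 * u0 / D) * u + (- D^-1) * u ^+ 2.
  by rewrite /P; field; rewrite gt_eqF.
have cPn n : continuous (fun u => P u ^+ n * f u).
  move=> z; apply: cvgM; last exact: cf.
  apply: (@continuous_comp _ _ _ P (fun z => z ^+ n)); first exact: cP.
  exact: exprn_continuous.
have Pn0 n : moments_vanish B (fun u => P u ^+ n * f u).
  elim: n => [|n IH].
    by move=> m; under eq_Rintegral do rewrite expr0 mul1r; exact: f0.
  have := moments_vanish_quadratic B (1 + (d ^+ 2 - u0 ^+ 2) / D) (2 * u0 / D) (- D^-1) _ (cPn n) IH.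
  move=> H m; rewrite -(H m); apply: eq_Rintegral => u _. rewrite -PE exprS; by rewrite !mulrA.
(* Bernoulli's inequality: linear growth in [n] is enough to beat a fixed bound. *)
have bern n : n%:R * q <= (1 + q) ^+ n.
  suff : 1 + n%:R * q <= (1 + q) ^+ n by lra.
  elim: n => [|n IH]; first by rewrite mul0r addr0 expr0.
  rewrite exprS (@le_trans _ _ ((1 + q) * (1 + n%:R * q)))//.
    have : 0 <= n%:R * q * q.
      by apply: mulr_ge0; [apply: mulr_ge0; [exact: ler0n|exact: ltW]|exact: ltW].
    by rewrite -natr1; lra.
  by rewrite ler_wpM2l//; lra.
pose A := `[u0 - d / 2, u0 + d / 2]%classic : set R.
have mA : measurable A by exact: measurable_itv.
have AB : A `<=` `[- B, B].
  move=> u; rewrite /A /= !in_itv /= => /andP[ua ub].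
  have := ler_norm u0; have := ler_norm (- u0); rewrite normrN => *.
  by apply/andP; split; lra.
(* Three zones: on [A] the product is at least [n%:R * q * e], between [d / 2] and [d] it is
   nonnegative, and beyond [d] it is at least [- N0]. Subtracting [N0] everywhere unites them. *)
have lb n u : `[- B, B]%classic u ->
    ((fun=> n%:R * q * e) \_ A) u - N0 <= P u ^+ n * f u.
  rewrite /= in_itv /= -ler_norml => uB.
  rewrite patchE; case: ifPn => [|_].
    rewrite inE /A /= in_itv /= => uA.
    have ud : `|u - u0| <= d / 2 by rewrite ler_distl; lra.
    have efu : e <= f u by apply: fd; lra.
    have Pq : 1 + q <= P u.
      rewrite /P /q lerD2l ler_pM2r ?invr_gt0//.
      have : (u - u0) ^+ 2 <= (d / 2) ^+ 2.
        by rewrite -[leLHS]real_normK ?num_real// ler_pXn2r ?nnegrE//; lra.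
      by rewrite expr_div_n; lra.
    rewrite (@le_trans _ _ (n%:R * q * e))//; first by lra.
    apply: ler_pM => //; [by rewrite mulr_ge0// ltW|exact: ltW|].
    rewrite (le_trans (bern n))//.
    by apply: lerXn2r => //; rewrite nnegrE; lra.
  have [ud|du] := leP `|u - u0| d.
    have efu : e <= f u by exact: fd.
    have P0 : 0 <= P u.
      rewrite /P addr_ge0// divr_ge0 ?(ltW D0)// subr_ge0.
      by rewrite -[leLHS]real_normK ?num_real// ler_pXn2r ?nnegrE//; lra.
    by rewrite sub0r (@le_trans _ _ 0) ?oppr_le0// mulr_ge0 ?exprn_ge0//; lra.
  rewrite sub0r.
  have P1 : `|P u| <= 1.
    have h1 : d ^+ 2 <= (u - u0) ^+ 2.
      by rewrite -[leRHS]real_normK ?num_real// ler_pXn2r ?nnegrE//; lra.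
    have h2 : (u - u0) ^+ 2 <= (2 * B) ^+ 2.
      rewrite -[leLHS]real_normK ?num_real// ler_pXn2r ?nnegrE//; last by lra.
      by rewrite (le_trans (ler_normB _ _))//; lra.
    have h3 : (d ^+ 2 - (u - u0) ^+ 2) / D <= 0.
      by rewrite pmulr_lle0 ?invr_gt0//; lra.
    have h4 : - 2 <= (d ^+ 2 - (u - u0) ^+ 2) / D.
      rewrite ler_pdivlMr// /D.
      have := sqr_ge0 d; rewrite exprMn in h2; lra.
    by rewrite /P ler_norml; apply/andP; split; lra.
  have : `|P u ^+ n * f u| <= N0.
    rewrite normrM normrX -[leRHS]mul1r ler_pM//; last exact: fN.
    exact: exprn_ile1.
  by rewrite ler_norml => /andP[].
have iA (c : R) : (@lebesgue_measure R).-integrable `[- B, B] (EFin \o ((fun=> c) \_ A)).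
  rewrite -restrict_EFin; apply/integrable_restrict => //.
  apply: (integrableS _ _ _ (integrable_cst_itv (- B) B c)) => //.
  exact: measurableI.
(* Integrate [lb]: the right side has integral zero and [A] has length [d]. The resulting bound,
   uniform in [n], contradicts the Archimedean property. *)
have ub n : n%:R * q * e * d <= N0 * (2 * B).
  have H : \int[lebesgue_measure]_(u in `[- B, B]) (((fun=> n%:R * q * e) \_ A) u - N0)
      <= \int[lebesgue_measure]_(u in `[- B, B]) (P u ^+ n * f u).
    apply: le_Rintegral => //.
    - under [X in _.-integrable _ X]eq_fun do rewrite /= EFinB.
      apply: integrableB => //.
        exact: iA.
      exact: integrable_cst_itv.
    - exact: integrable_continuous.
    - by move=> u; exact: lb.
  have := Pn0 n 0%N.
  under eq_Rintegral do rewrite expr0 mul1r.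
  move=> H0; rewrite H0 in H; move: H.
  rewrite RintegralB//; last first.
    exact: integrable_cst_itv.
  have -> : \int[lebesgue_measure]_(u in `[- B, B]) ((fun=> n%:R * q * e) \_ A) u
      = n%:R * q * e * (u0 + d / 2 - (u0 - d / 2)).
    rewrite -Rintegral_mkcondr setIC (setIidl AB).
    by apply: Rintegral_cst_itv; lra.
  have -> : \int[lebesgue_measure]_(u in `[- B, B]) N0 = N0 * (B - - B).
    by apply: Rintegral_cst_itv; lra.
  by lra.
have qed : 0 < q * e * d by apply: mulr_gt0 => //; exact: mulr_gt0.
have r0 : 0 <= N0 * (2 * B) / (q * e * d).
  by apply: divr_ge0; [apply: mulr_ge0; lra|exact: ltW].
have := archi_boundP r0; rewrite ltr_pdivrMr// ltNge => /negP; apply.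
by have := ub (Num.bound (N0 * (2 * B) / (q * e * d))); rewrite !mulrA.
Qed.

Lemma moments_vanish_eq0 {R : realType} (B u0 : R) (f : R -> R) :
  continuous f -> moments_vanish B f -> `|u0| < B -> f u0 = 0.
Proof.
move=> cf f0 u0B; apply/eqP; rewrite eq_le (moments_vanish_le0 B)//=.
rewrite -oppr_le0; apply: (moments_vanish_le0 B u0 (fun u => - f u)) => //.
  by move=> z; apply: cvgN; exact: cf.
move=> n; have := f0 n; rewrite -[X in _ -> X = _]opprK => H.
under eq_Rintegral do rewrite mulrN -mulN1r.
rewrite RintegralZl ?H ?mulr0 ?oppr0//; apply: integrable_continuous.
exact: continuous_moment.
Qed.

(** * From circles to lines *)

(** Serves to discard the lower half of a circle and to exchange [[p - r, p + r]] for [[- B, B]]. *)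
Lemma Rintegral_support {R : realType} (A B : set R) (f : R -> R) :
  (forall t, f t != 0 -> (A t <-> B t)) ->
  \int[lebesgue_measure]_(t in A) f t = \int[lebesgue_measure]_(t in B) f t.
Proof.
move=> AB; rewrite Rintegral_mkcond [RHS]Rintegral_mkcond.
apply: eq_Rintegral => t _; rewrite !patchE.
have [->|/AB tAB] := eqVneq (f t) 0; first by do 2 case: ifP.
by rewrite (_ : (t \in A) = (t \in B))//; apply/idP/idP; rewrite !inE => /tAB.
Qed.

(** The function [k] of the header. The maximum with [e] makes the quotient
    continuous and changes nothing when [h] vanishes below height [e]. *)
Definition line_chart {R : realType} (h : R * R -> R) (e u w : R) : R :=
  h (u, Num.sqrt (w - u ^+ 2)) / Num.max e (Num.sqrt (w - u ^+ 2)).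

Lemma continuous_line_chart {R : realType} (h : R * R -> R) (e : R) :
  0 < e -> continuous h ->
  continuous (fun z : R * R => line_chart h e z.1 z.2).
Proof.
move=> e0 ch z.
have cs : {for z, continuous (fun z : R * R => Num.sqrt (z.2 - z.1 ^+ 2))}.
  apply: (@continuous_comp _ _ _ (fun z : R * R => z.2 - z.1 ^+ 2) Num.sqrt).
    apply: cvgB; first exact: cvg_snd.
    apply: (@continuous_comp _ _ _ (fun z : R * R => z.1) (fun z : R => z ^+ 2)).
      exact: cvg_fst.
    exact: exprn_continuous.
  exact: sqrt_continuous.
apply: cvgM.
  apply: (@continuous_comp _ _ _ (fun z : R * R => (z.1, Num.sqrt (z.2 - z.1 ^+ 2))) h); last exact: ch.
  exact: (@cvg_pair _ _ _ (nbhs z) (nbhs z.1) (nbhs (Num.sqrt (z.2 - z.1 ^+ 2))) _ _ _ _ _ cvg_fst cs).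
apply: cvgV; first by rewrite gt_eqF// lt_max e0.
apply: (@continuous_max R _ (fun=> e) (fun z : R * R => Num.sqrt (z.2 - z.1 ^+ 2))) => //.
exact: cvg_cst.
Qed.

(** [Num.sqrt] is 0 on nonpositive arguments, and [h] vanishes at height 0 because [0 < e]. *)
Lemma line_chart_eq0 {R : realType} (h : R * R -> R) (e u w : R) :
  0 < e -> (forall u v, v < e -> h (u, v) = 0) ->
  w <= u ^+ 2 -> line_chart h e u w = 0.
Proof.
move=> e0 he wu.
by rewrite /line_chart (ler0_sqrtr (_ : _ <= 0)) ?subr_le0// he ?mul0r.
Qed.

Lemma line_chart_sqr {R : realType} (h : R * R -> R) (e u v : R) :
  0 < e -> (forall u v, v < e -> h (u, v) = 0) ->
  0 <= v -> line_chart h e u (u ^+ 2 + v ^+ 2) * v = h (u, v).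
Proof.
move=> e0 he v0; rewrite /line_chart addrAC subrr add0r sqrtr_sqr ger0_norm//.
have [ve|ev] := ltP v e; first by rewrite he// !mul0r.
by rewrite divfK// gt_eqF// (lt_le_trans e0).
Qed.

Lemma line_chart_bound {R : realType} (h : R * R -> R) (e M u w : R) :
  0 < e -> (forall z, `|h z| <= M) -> `|line_chart h e u w| <= M / e.
Proof.
move=> e0 hM; rewrite /line_chart normrM; apply: ler_pM => //.
rewrite normfV ger0_norm ?le_max ?(ltW e0)// lef_pV2 ?posrE ?lt_max ?e0//.
by rewrite le_max lexx.
Qed.

(** Substitute [u = p + r * sin t] on the upper half circle: [du = v dt] with [v = r * cos t], so
    [h dt] becomes [(h / v) du]. On the circle [u ^+ 2 + v ^+ 2] equals
    [r ^+ 2 - p ^+ 2 + 2 * p * u], which is affine in [u]. *)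
Lemma Rintegral_circle_line {R : realType} (h : R * R -> R) (e B p r : R) :
  0 < e -> (forall u v, v < e -> h (u, v) = 0) ->
  continuous h -> (forall u v, B < `|u| -> h (u, v) = 0) -> 0 < r ->
  \int[lebesgue_measure]_(t in `[- pi, pi]) h (p + r * sin t, r * cos t) =
  \int[lebesgue_measure]_(u in `[- B, B])
    line_chart h e u (r ^+ 2 - p ^+ 2 + 2 * p * u).
Proof.
move=> e0 he ch hB r0.
have pi0 := pi_gt0 R.
pose G u := line_chart h e u (r ^+ 2 - p ^+ 2 + 2 * p * u).
pose F t : R := p + r * sin t.
have cG : continuous G.
  apply: (continuous_curve (line_chart h e) id (fun u => r ^+ 2 - p ^+ 2 + 2 * p * u)).
  - exact: continuous_line_chart.
  - by move=> z; exact: cvg_id.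
  - move=> z; apply: cvgD; first exact: cvg_cst.
    by apply: cvgM; [exact: cvg_cst|exact: cvg_id].
have dF (t : R) : is_derive t 1 F (r * cos t).
  have d : is_derive t 1 ((fun=> p) + (r \*: sin)) (0 + r *: cos t).
    by apply: is_deriveD.
  by rewrite add0r in d.
have F'E : (derive1 F) = fun t => r * cos t.
  by apply/funext => t; rewrite derive1E (@derive_val _ _ _ _ _ _ _ (dF t)).
have cF' : continuous (derive1 F).
  rewrite F'E => z; apply: cvgM; first exact: cvg_cst.
  exact: continuous_cos.
have cF : continuous F.
  move=> z; apply: cvgD; first exact: cvg_cst.
  by apply: cvgM; [exact: cvg_cst|exact: continuous_sin].
have Fa : F (- (pi / 2)) = p - r by rewrite /F sinN sin_pihalf mulrN1.
have Fb : F (pi / 2) = p + r by rewrite /F sin_pihalf mulr1.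
(* Where [cos t <= 0] the point is not above the axis and [h] is zero. *)
transitivity (\int[lebesgue_measure]_(t in `[- (pi / 2), pi / 2]) h (p + r * sin t, r * cos t)).
  apply: Rintegral_support => t; rewrite /= !in_itv /=.
  have [ct0|ct0 _] := leP (cos t) 0.
    rewrite he ?eqxx// (le_lt_trans _ e0)//.
    by rewrite pmulr_rle0.
  split => [/andP[t1 t2]|/andP[t1 t2]]; last by apply/andP; split; lra.
  apply/andP; split; rewrite leNgt; apply/negP => ht; move: ct0; apply/negP; rewrite -leNgt.
    rewrite -cosN -[- t](subrK (pi / 2)) cosDpihalf oppr_le0.
    by apply: sin_ge0_pi; apply/andP; split; lra.
  rewrite -[t](subrK (pi / 2)) cosDpihalf oppr_le0.
  by apply: sin_ge0_pi; apply/andP; split; lra.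
have S : (\int[lebesgue_measure]_(x in `[F (- (pi / 2))%R, F (pi / 2)%R]) (G x)%:E =
  \int[lebesgue_measure]_(x in `[(- (pi / 2))%R, (pi / 2)%R])
    (((G \o F) * derive1 F)%R x)%:E)%E.
  apply: integration_by_substitution_increasing.
  - lra.
  - by move=> s t sI tI st; rewrite /F ltrD2l ltr_pM2l// ltr_sin.
  - by move=> t _; exact: cF'.
  - by apply/cvg_ex; eexists; apply: cvg_at_right_filter; exact: cF'.
  - by apply/cvg_ex; eexists; apply: cvg_at_left_filter; exact: cF'.
  - split.
    + by move=> t _; exact: (@ex_derive _ _ _ _ _ _ _ (dF t)).
    + by apply: cvg_at_right_filter; exact: cF.
    + by apply: cvg_at_left_filter; exact: cF.
  - exact: continuous_subspaceT.
transitivity (\int[lebesgue_measure]_(x in `[- (pi / 2), pi / 2]) ((G \o F) * (derive1 F)) x).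
  apply: eq_Rintegral => t; rewrite inE /= in_itv /= => tI.
  rewrite fctE /= F'E /G /F.
  have -> : r ^+ 2 - p ^+ 2 + 2 * p * (p + r * sin t) =
      (p + r * sin t) ^+ 2 + (r * cos t) ^+ 2.
    have := cos2Dsin2 t => cs.
    have -> : (p + r * sin t) ^+ 2 + (r * cos t) ^+ 2 =
      p ^+ 2 + 2 * p * r * sin t + r ^+ 2 * (cos t ^+ 2 + sin t ^+ 2) by ring.
    by rewrite cs; ring.
  by rewrite line_chart_sqr// mulr_ge0 ?cos_ge0_pihalf// ltW.
rewrite /Rintegral -S Fa Fb -/(Rintegral _ _ _).
(* Both intervals contain every [u] with [G u != 0]: if [r < |u - p|], the line lies below the
   parabola [w = u ^+ 2]. *)
apply: Rintegral_support => u Gu0.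
have uB : `|u| <= B.
  rewrite leNgt; apply/negP => uB; move: Gu0; rewrite /G /line_chart hB// mul0r.
  by rewrite eqxx.
have ur : `|u - p| <= r.
  rewrite leNgt; apply/negP => ur; move: Gu0; rewrite /G line_chart_eq0 ?eqxx//.
  have : r ^+ 2 <= (u - p) ^+ 2.
    by rewrite -[leRHS]real_normK ?num_real// ler_pXn2r ?nnegrE//; lra.
  by lra.
rewrite /= !in_itv /=; split => _; first by rewrite -ler_norml.
by rewrite -ler_distl.
Qed.

(** * Bounds from compact support and linearity of the mean *)

Lemma compact_continuous_bounded {R : realType} (T : topologicalType) (K : set T) (f : T -> R) :
  compact K -> {in K, continuous f} ->
  exists2 N : R, 0 < N & forall z, K z -> `|f z| <= N.
Proof.
move=> cK cf.
have /compact_bounded[M [_ HM]] : compact (f @` K).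
  by apply: continuous_compact => //; exact: continuous_in_subspaceT.
exists (`|M| + 1); first by rewrite ltr_wpDl.
move=> z Kz; apply: (HM (`|M| + 1)); last by exists z.
by rewrite (le_lt_trans (ler_norm M))// ltrDl.
Qed.

Lemma supp_compact_upper_bounds {R : realType} (h : R * R -> R) :
  continuous h -> supp_compact_upper h ->
  exists e B M : R, [/\ 0 < e, forall u v, v < e -> h (u, v) = 0,
    forall u v, B < `|u| -> h (u, v) = 0 & forall z, `|h z| <= M].
Proof.
move=> ch [K [cK [K0 hK]]].
(* A bound [N] for the reciprocal height on [K] gives the gap [N^-1] between the support and the
   axis. *)
have cV : {in K, continuous (fun z : R * R => z.2^-1)}.
  move=> z /set_mem Kz; apply: cvgV; first by rewrite gt_eqF// K0.
  exact: cvg_snd.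
have [N N0 HN] := compact_continuous_bounded _ _ _ cK cV.
have [B B0 HB] := @compact_continuous_bounded R _ K (fun z => z.1) cK (fun z _ => cvg_fst).
have [M M0 HM] := @compact_continuous_bounded R _ K h cK (fun z _ => ch z).
exists N^-1, B, M; split.
- by rewrite invr_gt0.
- move=> u v vN; apply: hK => Kz; have := HN _ Kz; have v0 : 0 < v := K0 _ Kz.
  rewrite /= ger0_norm ?invr_ge0 ?(ltW v0)// => vN'.
  have : N^-1 <= v by rewrite -[v]invrK lef_pV2 ?posrE ?invr_gt0.
  by rewrite leNgt vN.
- by move=> u v Bu; apply: hK => Kz; have := HB _ Kz; rewrite leNgt /= Bu.
- move=> z; have [Kz|nKz] := pselect (K z); first exact: HM.
  by rewrite hK// normr0 ltW.
Qed.

Lemma supp_compact_upperB {R : realType} (f g : R * R -> R) :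
  supp_compact_upper f -> supp_compact_upper g ->
  supp_compact_upper (fun z => f z - g z).
Proof.
move=> [K [cK [K0 fK]]] [L [cL [L0 gL]]].
exists (K `|` L); split; first exact: compactU.
split; first by move=> z [/K0|/L0].
move=> z nKL; rewrite fK ?gL ?subrr// => ?; apply: nKL; [by right|by left].
Qed.

Lemma circ_meanB {R : realType} (f g : R * R -> R) (p r : R) :
  continuous f -> continuous g ->
  circ_mean (fun z => f z - g z) p r = circ_mean f p r - circ_mean g p r.
Proof.
move=> cf cg; rewrite /circ_mean -mulrBr; congr (_ * _).
have ci (h : R * R -> R) : continuous h -> (@lebesgue_measure R).-integrable `[- pi, pi]
    (EFin \o (fun t => h (p + r * sin t, r * cos t))).
  move=> ch; apply: integrable_continuous.
  apply: (continuous_curve (fun u v => h (u, v)) (fun t => p + r * sin t) (fun t => r * cos t)).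
  - by move=> [u v]; have := ch (u, v); rewrite (_ : (fun z => h (z.1, z.2)) = h)//; apply/funext => -[].
  - move=> t; apply: cvgD; first exact: cvg_cst.
    by apply: cvgM; [exact: cvg_cst|exact: continuous_sin].
  - by move=> t; apply: cvgM; [exact: cvg_cst|exact: continuous_cos].
by rewrite RintegralB//; exact: ci.
Qed.

(** * Vanishing above the centre and conclusion *)

(** The bound [r < y] is strict because the moments are controlled only for offsets strictly below
    [y ^+ 2 - p ^+ 2], leaving room to vary [p]. *)
Lemma circ_mean_eq0_vanish {R : realType} (h : R * R -> R) (x y : R) (U : set R) :
  continuous h -> supp_compact_upper h -> open U -> U x ->
  (forall p r, U p -> 0 <= r -> r <= y -> circ_mean h p r = 0) ->
  forall r, 0 < r -> r < y -> h (x, r) = 0.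
Proof.
move=> ch sh oU Ux m0 r r0 ry.
have [e [B0 [M [e0 he hB0 hM]]]] := supp_compact_upper_bounds h ch sh.
have M0 : 0 <= M by rewrite (le_trans _ (hM 0)).
(* Enlarged so that [x] is interior to [[- B, B]], where vanishing moments give pointwise
   information. *)
pose B := Num.max B0 (`|x| + 1).
have xB : `|x| < B by rewrite lt_max ltrDl ltr01 orbT.
have Bge0 : 0 <= B by rewrite (le_trans _ (ltW xB)).
have hB u v : B < `|u| -> h (u, v) = 0.
  by move=> Bu; apply: hB0; rewrite (le_lt_trans _ Bu)// le_max lexx.
pose k := line_chart h e.
have ck : continuous (fun z : R * R => k z.1 z.2) by exact: continuous_line_chart.
have kM u w : `|k u w| <= M / e by exact: line_chart_bound.
have k0 (u w : R) : w <= 0 -> k u w = 0.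
  by move=> w0; rewrite /k line_chart_eq0// (le_trans w0)// sqr_ge0.
have kB (u w : R) : B < `|u| -> k u w = 0.
  by move=> uB; rewrite /k /line_chart hB// mul0r.
have line0 p c : U p -> c < y ^+ 2 - p ^+ 2 ->
    \int[lebesgue_measure]_(u in `[- B, B]) k u (c + 2 * p * u) = 0.
  move=> Up cp.
  (* If [c + p ^+ 2 <= 0], the line never rises above the parabola [w = u ^+ 2]; otherwise it comes
     from the circle of radius [Num.sqrt (c + p ^+ 2)]. *)
  have [s0|s0] := leP (c + p ^+ 2) 0.
    rewrite (@eq_Rintegral _ _ R (@lebesgue_measure R) _ (fun=> 0)).
      by rewrite Rintegral_cst_itv ?mul0r//; lra.
    move=> u _; rewrite /k line_chart_eq0//.
    by have := sqr_ge0 (u - p); lra.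
  have cE : c = (Num.sqrt (c + p ^+ 2)) ^+ 2 - p ^+ 2 by rewrite sqr_sqrtr ?ltW// addrK.
  rewrite [in LHS]cE -Rintegral_circle_line ?sqrtr_gt0//.
  have sy : Num.sqrt (c + p ^+ 2) <= y.
    rewrite -[leRHS]ger0_norm; last by lra.
    by rewrite -sqrtr_sqr ler_sqrt ?exprn_ge0//; lra.
  have := m0 p _ Up (sqrtr_ge0 _) sy; rewrite /circ_mean => /eqP.
  by rewrite mulf_eq0 invr_eq0 mulf_eq0 pnatr_eq0 /= (gt_eqF (pi_gt0 R)) => /eqP.
have moments n p c : U p -> c < y ^+ 2 - p ^+ 2 ->
    \int[lebesgue_measure]_(u in `[- B, B]) (u ^+ n * k u (c + 2 * p * u)) = 0.
  elim: n p c => [|n IH] p c Up cp.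
    by under eq_Rintegral do rewrite expr0 mul1r; exact: line0.
  under eq_Rintegral do rewrite exprS -mulrA.
  apply: (line_integral_mul (fun u w => u ^+ n * k u w) (B ^+ n * (M / e)) B (y ^+ 2) U) => //.
  - move=> z; apply: cvgM; last exact: ck.
    apply: (@continuous_comp _ _ _ (fun z : R * R => z.1) (fun z : R => z ^+ n)).
      exact: cvg_fst.
    exact: exprn_continuous.
  (* The factor [u ^+ n] is unbounded, but [k] vanishes for [B < |u|]. *)
  - move=> u w; have [uB|uB] := leP `|u| B; last first.
      by rewrite kB// mulr0 normr0 mulr_ge0 ?exprn_ge0// divr_ge0// ltW.
    by rewrite normrM normrX ler_pM// lerXn2r// nnegrE.
  - by move=> u w w0; rewrite k0// mulr0.
have := moments_vanish_eq0 B x (fun u => k u ((r ^+ 2 - x ^+ 2) + 2 * x * u)).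
move=> /(_ _ _ xB) H.
(* The line of centre [x] and radius [r] passes over [u = x] at [w = x ^+ 2 + r ^+ 2], the chart
   point of [(x, r)]. *)
have kx : k x (x ^+ 2 + r ^+ 2) = 0.
  rewrite (_ : x ^+ 2 + r ^+ 2 = r ^+ 2 - x ^+ 2 + 2 * x * x); last by ring.
  apply: H.
    apply: (continuous_curve k id (fun u => r ^+ 2 - x ^+ 2 + 2 * x * u)) => //.
      by move=> z; exact: cvg_id.
    move=> z; apply: cvgD; first exact: cvg_cst.
    by apply: cvgM; [exact: cvg_cst|exact: cvg_id].
  move=> n; apply: moments => //.
  by rewrite ltrD2r ltr_pXn2r// nnegrE; lra.
by rewrite -(line_chart_sqr h e) ?(ltW r0)// -/k kx mul0r.
Qed.

Theorem theorem1 (R : realType) (f g : R * R -> R) (x y : R) :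
  continuous f -> continuous g ->
  supp_compact_upper f -> supp_compact_upper g ->
  0 < y ->
  (exists U : set R, open U /\ U x /\
     (forall p r, U p -> 0 <= r -> r <= y -> circ_mean f p r = circ_mean g p r)) ->
  f (x, y) = g (x, y).
Proof.
move=> cf cg sf sg y0 [U [oU [Ux mfg]]].
pose h z := f z - g z.
have ch : continuous h by move=> z; apply: cvgB; [exact: cf|exact: cg].
have h0 : forall r, 0 < r -> r < y -> h (x, r) = 0.
  apply: (circ_mean_eq0_vanish h x y U) => //; first exact: supp_compact_upperB.
  by move=> p r Up r0 ry; rewrite circ_meanB// mfg// subrr.
have chx : continuous (fun v => h (x, v)).
  apply: (continuous_uncurry_l (fun u v => h (u, v)) x).
  by move=> [u v]; have := ch (u, v); rewrite (_ : (fun z => h (z.1, z.2)) = h)//; apply/funext => -[].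
(* Height [y] itself is reached as a left limit of heights where [h] is known to vanish. *)
have l1 : h (x, v) @[v --> y^'-] --> h (x, y) by apply: cvg_at_left_filter; exact: chx.
have l2 : h (x, v) @[v --> y^'-] --> (0 : R).
  apply: cvg_near_cst; near=> v; apply: h0; near: v.
    exact: nbhs_left_gt.
  exact: nbhs_left_lt.
by apply/eqP; rewrite -subr_eq0; apply/eqP; exact: (cvg_unique _ l1 l2).
Unshelve. all: by end_near. Qed.
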